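(* Let $n\ge 1$ and let $J$ be the $\mathbb{Z}[D_{4n}]$-module defined in the context. Then $J$ has minimal $\mathbb{Z}$-rank in its stable class; that is, every $\mathbb{Z}[D_{4n}]$-module $K$ that is stably equivalent to $J$ satisfies $\operatorname{rk}_{\mathbb{Z}}K\ge\operatorname{rk}_{\mathbb{Z}}J$.
   Context: $D_{4n}$ (subscript = order) is the dihedral group with presentation $\langle a,b\mid a^{2n}=b^2=e,\ aba=b\rangle$. Modules are right modules. Two modules $L,N$ over a ring $R$ are stably equivalent if $L\oplus R^a\cong N\oplus R^b$ for some integers $a,b\ge 0$; the stable class of $J$ is the set of modules stably equivalent to $J$. Definition of $J$: let $\Sigma=\sum_{i=0}^{2n-1}a^i$. Let $\mathbb{Z}[D_{4n}]^3$ have basis $E_1,E_2,E_3$ and $\mathbb{Z}[D_{4n}]^2$ have basis $e_1,e_2$, and define $\partial_2:\mathbb{Z}[D_{4n}]^3\to\mathbb{Z}[D_{4n}]^2$ by $\partial_2E_1=e_1\Sigma$, $\partial_2E_2=e_2(1+b)$, $\partial_2E_3=e_1(1+ba)+e_2(a-1)$. Then $J=\ker\partial_2$. *)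

(* Defs.v *)
From HB Require Import structures.
From mathcomp Require Import all_boot all_order all_fingroup all_algebra all_solvable.

Set Implicit Arguments.
Unset Strict Implicit.
Unset Printing Implicit Defensive.

Import GRing.Theory.
Local Open Scope ring_scope.

(** Since ['D_(4 * n)] has order [4 * n], a generating pair satisfying the
    relations is the same thing as a pair of generators for the presentation
    [< a, b | a ^ 2n = b ^ 2 = e, a b a = b >]. *)
Definition dihedral_generators (n : nat) (a b : 'D_(4 * n)) : Prop :=
  [/\ (<<[set a; b]>> = 'D_(4 * n))%g,
      (a ^+ (2 * n) = 1)%g, (b ^+ 2 = 1)%g & (a * b * a = b)%g].

Lemma dihedral_generators_exist (n : nat) :
  (0 < n)%N -> exists a b : 'D_(4 * n), dihedral_generators a b.
Proof.
move=> n_gt0; have q_gt1 : (1 < 2 * n)%N by rewrite mul2n -addnn (leq_add n_gt0).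
have := Grp_dihedral q_gt1.
rewrite (_ : (2 * n).*2 = (4 * n)%N) => [isoD|]; last by rewrite -mul2n mulnA.
have /existsP[[a b] /=] : ('D_(4 * n) \homg Grp
    (x : y : x ^+ (2 * n), y ^+ 2, x ^ y = x^-1))%g by rewrite -isoD homg_refl.
rewrite /= !xpair_eqE => /and4P[/eqP defG /eqP aq /eqP b2 /eqP ab].
exists a, b; split=> //; first by rewrite -{}defG joing_idl joing_idr.
by rewrite (conjgC a b) ab mulgKV.
Qed.

(** The integral group ring: functions [G -> Z] under convolution.  An alias is
    needed because [{ffun G -> int}] carries the pointwise product. *)
Definition zgring (gT : finGroupType) : Type := {ffun gT -> int}.

Section GroupRing.
Variable gT : finGroupType.
Implicit Types (x y z : zgring gT) (g h : gT).

HB.instance Definition _ := GRing.Zmodule.copy (zgring gT) {ffun gT -> int}.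

Definition zg_of g : zgring gT := [ffun h => (h == g)%:R].

Definition zg_mul x y : zgring gT := [ffun g => \sum_h x h * y (h^-1 * g)%g].

Fact zg_mulA : associative zg_mul.
Proof.
move=> x y z; apply/ffunP=> g; rewrite !ffunE.
under eq_bigr => h _ do rewrite ffunE big_distrr /=.
under [RHS]eq_bigr => k _ do rewrite ffunE big_distrl /=.
rewrite [RHS]exchange_big /=; apply: eq_bigr => h _.
rewrite [RHS](reindex_inj (mulgI h)) /=; apply: eq_bigr => k _.
by rewrite mulKg invMg !mulgA mulrA.
Qed.

Fact zg_mul1l : left_id (zg_of 1) zg_mul.
Proof.
move=> x; apply/ffunP=> g; rewrite ffunE (bigD1 1%g) //= big1 => [|h /negPf h1].
  by rewrite ffunE eqxx mul1r invg1 mul1g addr0.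
by rewrite ffunE h1 mul0r.
Qed.

Fact zg_mul1r : right_id (zg_of 1) zg_mul.
Proof.
move=> x; apply/ffunP=> g; rewrite ffunE (bigD1 g) //= big1 => [|h /negPf hg].
  by rewrite ffunE mulVg eqxx mulr1 addr0.
by rewrite ffunE -eq_invg_mul invgK hg mulr0.
Qed.

Fact zg_mulDl : left_distributive zg_mul +%R.
Proof.
move=> x y z; apply/ffunP=> g; rewrite !ffunE -big_split /=.
by apply: eq_bigr => h _; rewrite ffunE mulrDl.
Qed.

Fact zg_mulDr : right_distributive zg_mul +%R.
Proof.
move=> x y z; apply/ffunP=> g; rewrite !ffunE -big_split /=.
by apply: eq_bigr => h _; rewrite ffunE mulrDr.
Qed.

Fact zg_oner_neq0 : zg_of 1 != 0.
Proof. by apply/eqP=> /ffunP/(_ 1%g); rewrite !ffunE eqxx. Qed.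

HB.instance Definition _ := GRing.Zmodule_isNzRing.Build (zgring gT)
  zg_mulA zg_mul1l zg_mul1r zg_mulDl zg_mulDr zg_oner_neq0.

Lemma zg_ofM g h : zg_of (g * h)%g = zg_of g * zg_of h.
Proof.
apply/ffunP=> k; rewrite !ffunE (bigD1 g) //= big1 => [|l /negPf lg].
  by rewrite !ffunE eqxx mul1r addr0 -(inj_eq (mulgI g^-1%g)) mulKg.
by rewrite ffunE lg mul0r.
Qed.

End GroupRing.

Section Kernel.
Variables (R : nzRingType) (U V : lmodType R) (f : {linear U -> V}).

Definition in_ker : {pred U} := fun u => f u == 0.

Fact in_ker_submod_closed : submod_closed in_ker.
Proof.
split=> [|r u v]; rewrite !unfold_in; first by rewrite linear0.
by move=> /eqP fu /eqP fv; rewrite linearP fu fv scaler0 addr0.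
Qed.

HB.instance Definition _ := GRing.isSubmodClosed.Build R U in_ker
  in_ker_submod_closed.

Definition kernel : Type := {u : U | u \in in_ker}.

HB.instance Definition _ := SubChoice.on kernel.
HB.instance Definition _ := [SubChoice_isSubLmodule of kernel by <:].
End Kernel.

(** Right modules over [R] are left modules over the converse ring [R^c]; in
    particular ['rV[R^c]_m] is the free right [R]-module of rank [m], with
    [(r *: v) 0 i = v 0 i * r] for the product of [R]. *)

Definition stably_equivalent (R : nzRingType) (L N : lmodType R) : Prop :=
  exists (p q : nat) (f : {linear (L * 'rV[R]_p)%type -> (N * 'rV[R]_q)%type}),
    bijective f.

Definition Zindependent (M : zmodType) (r : nat) (v : 'I_r -> M) : Prop :=
  forall c : 'I_r -> int, \sum_i v i *~ c i = 0 -> forall i, c i = 0.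

(** The rank of an abelian group [M], i.e. the dimension of its
    rationalization; it need not exist when [M] is not finitely generated. *)
Definition is_Zrank (M : zmodType) (r : nat) : Prop :=
  (exists v : 'I_r -> M, Zindependent v) /\
  (forall (s : nat) (v : 'I_s -> M), Zindependent v -> (s <= r)%N).

Section J.
Variables (n : nat) (a b : 'D_(4 * n)).
Local Notation ZD := (zgring 'D_(4 * n)).

Definition Sigma : ZD := \sum_(i < (2 * n)%N) zg_of (a ^+ i)%g.

(** Row [i] lists the coordinates in [e_1, e_2] of the image of the basis vector
    [E_(i+1)]; the matrix acts on the right of row vectors over the converse
    ring, so [sum_i E_i r_i] is sent to [sum_i (d2 E_i) r_i]. *)
Definition d2_images (i : 'I_3) (j : 'I_2) : ZD :=
  match val i, val j with
  | 0%N, 0%N => Sigma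
  | 0%N, _ => 0
  | 1%N, 0%N => 0
  | 1%N, _ => 1 + zg_of b
  | _, 0%N => 1 + zg_of (b * a)%g
  | _, _ => zg_of a - 1
  end.

Definition d2_matrix : 'M[ZD^c]_(3, 2) := \matrix_(i, j) d2_images i j.

Definition d2 : {linear 'rV[ZD^c]_3 -> 'rV[ZD^c]_2} := mulmxr d2_matrix.

Lemma d2E (v : 'rV[ZD^c]_3) :
  d2 v 0 0 = (Sigma : ZD) * v 0 0 + (1 + zg_of (b * a)%g) * v 0 2 /\
  d2 v 0 1 = (1 + zg_of b : ZD) * v 0 1 + (zg_of a - 1) * v 0 2.
Proof.
have v1 : lift ord0 ord0 = 1 :> 'I_3 by apply: val_inj.
have v2 : lift ord0 (lift ord0 ord0) = 2 :> 'I_3 by apply: val_inj.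
split; rewrite !mxE !big_ord_recl big_ord0 !mxE /d2_images /= v1 v2.
  by rewrite mulr0 add0r addr0.
by rewrite mulr0 add0r addr0.
Qed.

Definition J : lmodType ZD^c := kernel d2.

End J.

(* Main.v *)
Require Import Defs.
From HB Require Import structures.
From mathcomp Require Import all_boot all_order all_fingroup all_algebra all_solvable.
From Stdlib Require Import Classical.

Import GRing.Theory.
Local Open Scope ring_scope.

(** Write [R] for the group ring, [N] for its norm element, and suppose that
    [K + R^p] is isomorphic to [J + R^q]. Since ranks are additive, the claim
    amounts to [p <= q], and this is read off from the elements fixed by the
    group.

    The fixed elements of [J] are the integral multiples of
    [w = N (1, 0, - n)] ([fixed_J_eq0], [norm_generator_exists]), whereas those
    of [R^q] are the integral multiples of [N] in each coordinate. Hence the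
    fixed elements of [J + R^q] form a group of rank [1 + q], and those of
    [K + R^p] a group of rank [p] plus the rank of the fixed elements of [K]. It
    remains to see that [K] has a nonzero fixed element.

    Otherwise every fixed element of [K + R^p] would be a multiple of the norm,
    hence so would [w] in [J]. The obstruction ([norm_generator_not_norm]) is
    the nonvanishing of the zeroth Tate cohomology group of [J], that is, of the
    Schur multiplier of the dihedral group. It has an elementary form: the
    character with [a] going to [1] and [b] to [-1] kills [1 + ba] and sends
    [Sigma] to [2n], so the first equation defining [J] shows that it kills the
    first coordinate of every element of [J]; that coordinate therefore has even
    augmentation, while [w = j N] would require augmentation 1
    ([augmentation_even]). *)

Set Implicit Arguments.
Unset Strict Implicit.

(** * Ranks of abelian groups *)

Lemma Zindependent_of_image (A B : zmodType) (phi : {additive A -> B}) (r : nat)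
    (v : 'I_r -> A) :
  Zindependent (fun i => phi (v i)) -> Zindependent v.
Proof.
move=> ind c cv0; apply: ind; have := congr1 phi cv0.
rewrite raddf_sum raddf0 => phi0; rewrite -[RHS]phi0.
by apply: eq_bigr => i _; rewrite raddfMz.
Qed.

Lemma Zindependent_inj (A B : zmodType) (phi : {additive A -> B}) (r : nat)
    (v : 'I_r -> A) :
  injective phi -> Zindependent v -> Zindependent (fun i => phi (v i)).
Proof.
move=> phiI ind c cv0; apply: ind; apply: phiI.
rewrite raddf_sum raddf0 -[RHS]cv0.
by apply: eq_bigr => i _; rewrite raddfMz.
Qed.

Lemma common_denominator (I : finType) (x : I -> rat) :
  exists2 d : int, d != 0 & exists c : I -> int, forall i, (c i)%:~R = x i * d%:~R.
Proof.
exists (\prod_i denq (x i)).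
  by apply/prodf_neq0 => i _; apply: denq_neq0.
exists (fun i => numq (x i) * \prod_(j | j != i) denq (x j)) => i.
by rewrite [in RHS](bigD1 i) //= !intrM numqE mulrA.
Qed.

(** If there were more vectors than coordinates, the matrix of the family would
    have a nonzero rational row kernel, and clearing denominators would turn it
    into an integral relation. Every upper bound on a rank below rests on this
    one. *)
Lemma Zindependent_ffun_le (I : finType) (s : nat) (v : 'I_s -> {ffun I -> int}) :
  Zindependent v -> (s <= #|I|)%N.
Proof.
move=> ind; pose M : 'M[rat]_(s, #|I|) := \matrix_(i, j) (v i (enum_val j))%:~R.
suff /eqP <- : row_free M by apply: rank_leq_col.
apply: inj_row_free => x xM0.
have [d d_neq0 [c cE]] := common_denominator (x 0).
have c0 : forall i, c i = 0.
  apply: ind; apply/ffunP=> k; rewrite sum_ffunE ffunE.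
  apply: (@intr_inj rat); rewrite rmorph_sum /=.
  have /rowP/(_ (enum_rank k)) := xM0; rewrite !mxE => sum0.
  rewrite mulr0z -[RHS](mul0r d%:~R) -[X in _ = X * _]sum0 mulr_suml.
  apply: eq_bigr => i _.
  by rewrite ffunMzE mulrzz intrM mxE enum_rankK cE mulrCA mulrA.
apply/rowP=> i; rewrite mxE; have /eqP := cE i.
by rewrite c0 eq_sym mulf_eq0 intr_eq0 (negPf d_neq0) orbF => /eqP.
Qed.

Lemma is_Zrank_ffun (I : finType) : is_Zrank {ffun I -> int} #|I|.
Proof.
split; last exact: Zindependent_ffun_le.
exists (fun i => [ffun k => (k == enum_val i)%:R]) => c cv0 i.
have /ffunP/(_ (enum_val i)) := cv0; rewrite sum_ffunE ffunE.
rewrite (bigD1 i) //= big1 ?addr0 => [|j /negPf ji].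
  by rewrite ffunMzE ffunE eqxx intz.
by rewrite ffunMzE ffunE (inj_eq enum_val_inj) eq_sym ji mul0rz.
Qed.

(** Spanning the rationalization: every element has a nonzero multiple in the
    span. Together with independence this witnesses the rank by data, which
    makes the rank of a direct sum computable. *)
Definition Zspanning (M : zmodType) (r : nat) (v : 'I_r -> M) : Prop :=
  forall m, exists2 c : int, c != 0 &
    exists d : {ffun 'I_r -> int}, m *~ c = \sum_i v i *~ d i.

(** An element no multiple of which lies in the span of a maximal independent
    family could be adjoined to that family. The relation is extracted
    classically, since independence in an arbitrary group is not
    decidable. *)
Lemma is_Zrank_spanning (M : zmodType) (r : nat) :
  is_Zrank M r -> exists2 v : 'I_r -> M, Zindependent v & Zspanning v.
Proof.
move=> [[v ind] max_r]; exists v => // m.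
pose w (i : 'I_r.+1) := oapp v m (unlift ord0 i).
apply: NNPP => no_rel; have /max_r : Zindependent w; last by rewrite ltnn.
move=> c; rewrite big_ord_recl {1}/w unlift_none /= => cw0.
have {}cw0 : m *~ c ord0 + \sum_i v i *~ c (lift ord0 i) = 0.
  by rewrite -[RHS]cw0; congr (_ + _); apply: eq_bigr => i _; rewrite /w liftK.
(* A nonzero coefficient of m would give exactly the relation that is denied. *)
have c00 : c ord0 = 0.
  apply/eqP/negPn/negP => c0; apply: no_rel; exists (c ord0); first exact: c0.
  exists [ffun i => - c (lift ord0 i)]; apply/eqP; rewrite -subr_eq0 -[X in _ == X]cw0.
  rewrite -sumrN; apply/eqP; congr (_ + _); apply: eq_bigr => i _.
  by rewrite ffunE mulrNz opprK.
move=> i; case: (unliftP ord0 i) => [j|] -> //; apply: (ind (fun j => c (lift ord0 j))).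
by rewrite -[RHS]cw0 c00 mulr0z add0r.
Qed.

(** Multiples of the members of any independent family have integral coordinates
    in the spanning family, and those coordinate vectors are independent too, so
    the bound for integral vectors applies. *)
Lemma spanning_is_Zrank (M : zmodType) (r : nat) (v : 'I_r -> M) :
  Zindependent v -> Zspanning v -> is_Zrank M r.
Proof.
move=> ind span; split=> [|s w indw]; first by exists v.
have /fin_all_exists[cd cdP] (i : 'I_s) : exists cd : int * {ffun 'I_r -> int},
    cd.1 != 0 /\ w i *~ cd.1 = \sum_j v j *~ cd.2 j.
  by have [c c0 [d cd]] := span (w i); exists (c, d).
rewrite -[r]card_ord; apply: (@Zindependent_ffun_le _ s (fun i => (cd i).2)) => e e0 i.
have : (cd i).1 * e i = 0.
  apply: (indw (fun i => (cd i).1 * e i)).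
  under eq_bigr => k _ do rewrite mulrzA (proj2 (cdP k)) mulrz_suml.
  rewrite exchange_big big1 // => j _ /=.
  under eq_bigr => k _ do rewrite -mulrzA.
  rewrite -mulrz_sumr; have /ffunP/(_ j) := e0; rewrite sum_ffunE ffunE => ej.
  rewrite (_ : \sum_k _ = 0) ?mulr0z // -[RHS]ej.
  by apply: eq_bigr => k _; rewrite ffunMzE mulrzz.
by move/eqP; rewrite mulf_eq0 (negPf (proj1 (cdP i))) => /eqP.
Qed.

Definition pair_family (A B : zmodType) (r s : nat) (u : 'I_r -> A) (v : 'I_s -> B)
    (i : 'I_(r + s)) : (A * B)%type :=
  match split i with inl j => (u j, 0) | inr k => (0, v k) end.

Lemma sum_pair_family (A B : zmodType) (r s : nat) (u : 'I_r -> A) (v : 'I_s -> B)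
    (c : 'I_(r + s) -> int) :
  \sum_i pair_family u v i *~ c i =
    (\sum_i u i *~ c (lshift s i), \sum_i v i *~ c (rshift r i)).
Proof.
rewrite [LHS]surjective_pairing !(raddf_sum fst) !(raddf_sum snd) !big_split_ord /=.
congr pair.
  rewrite [X in _ + X]big1 ?addr0 => [|i _]; last first.
    by rewrite (raddfMz fst) /pair_family (unsplitK (inr i)) mul0rz.
  by apply: eq_bigr => i _; rewrite (raddfMz fst) /pair_family (unsplitK (inl i)).
rewrite [X in X + _]big1 ?add0r => [|i _]; last first.
  by rewrite (raddfMz snd) /pair_family (unsplitK (inl i)) mul0rz.
by apply: eq_bigr => i _; rewrite (raddfMz snd) /pair_family (unsplitK (inr i)).
Qed.

Lemma Zindependent_pair (A B : zmodType) (r s : nat) (u : 'I_r -> A) (v : 'I_s -> B) :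
  Zindependent u -> Zindependent v -> Zindependent (pair_family u v).
Proof.
move=> indu indv c; rewrite sum_pair_family => -[cu cv] i.
have c_l := indu (fun j => c (lshift s j)) cu.
have c_r := indv (fun j => c (rshift r j)) cv.
by case: (split_ordP i) => j ->.
Qed.

Lemma Zspanning_pair (A B : zmodType) (r s : nat) (u : 'I_r -> A) (v : 'I_s -> B) :
  Zspanning u -> Zspanning v -> Zspanning (pair_family u v).
Proof.
move=> spanu spanv [x y]; have [c c0 [d cd]] := spanu x; have [e e0 [f ef]] := spanv y.
exists (c * e); first by rewrite mulf_neq0.
exists [ffun i => match split i with inl j => d j * e | inr k => f k * c end].
rewrite sum_pair_family [LHS]surjective_pairing (raddfMz fst) (raddfMz snd) /=.
congr pair.
  rewrite mulrzA cd mulrz_suml; apply: eq_bigr => i _.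
  by rewrite ffunE (unsplitK (inl i)) mulrzA.
rewrite mulrC mulrzA ef mulrz_suml; apply: eq_bigr => i _.
by rewrite ffunE (unsplitK (inr i)) mulrzA.
Qed.

Lemma is_Zrank_prod (A B : zmodType) (r s : nat) :
  is_Zrank A r -> is_Zrank B s -> is_Zrank (A * B)%type (r + s).
Proof.
move=> /is_Zrank_spanning[u indu spanu] /is_Zrank_spanning[v indv spanv].
exact: spanning_is_Zrank (Zindependent_pair indu indv) (Zspanning_pair spanu spanv).
Qed.

(** A subgroup need not come with a distinguished basis; the sizes of its
    independent families are bounded, so they have a maximum. *)
Lemma is_Zrank_of_inj (A B : zmodType) (phi : {additive A -> B}) (r : nat) :
  injective phi -> is_Zrank B r -> exists s, is_Zrank A s.
Proof.
move=> phiI [_ max_r].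
have: forall s (v : 'I_s -> A), Zindependent v -> (s <= r)%N.
  by move=> s v /(Zindependent_inj phiI); apply: max_r.
elim: r {max_r} => [|r IHr] max_r.
  by exists 0%N; split=> //; exists (fun=> 0) => c _ [].
have [ex_v | no_v] := classic (exists v : 'I_r.+1 -> A, Zindependent v).
  by exists r.+1.
apply: IHr => s v ind; have := max_r _ _ ind; rewrite leq_eqVlt => /predU1P[sr|//].
by case: no_v; rewrite -sr; exists v.
Qed.

Lemma is_Zrank_fst (A B : zmodType) (r : nat) :
  is_Zrank (A * B)%type r -> exists s, is_Zrank A s.
Proof.
have in1_add : zmod_morphism (fun x : A => (x, 0 : B)).
  by move=> x y; congr pair; rewrite /= subr0.
pose in1 := HB.pack_for {additive A -> (A * B)%type} (fun x : A => (x, 0 : B))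
  (GRing.isZmodMorphism.Build _ _ _ in1_add).
by apply: (is_Zrank_of_inj (phi := in1)) => x y [].
Qed.

Lemma is_Zrank_surj_le (A B : zmodType) (phi : {additive A -> B}) (r s : nat) :
  (forall y, exists x, phi x = y) -> is_Zrank A r -> is_Zrank B s -> (s <= r)%N.
Proof.
move=> phi_surj [_ max_r] [[v ind] _].
have /fin_all_exists[u uE] i := phi_surj (v i).
apply: (max_r s u); apply: (Zindependent_of_image (phi := phi)) => c.
by under eq_bigr => i _ do rewrite uE; apply: ind.
Qed.

Lemma is_Zrank_bij (A B : zmodType) (phi : {additive A -> B}) (r : nat) :
  bijective phi -> is_Zrank B r -> is_Zrank A r.
Proof.
move=> phi_bij [[v ind] max_r]; split=> [|s w indw]; last first.
  exact: max_r (Zindependent_inj (bij_inj phi_bij) indw).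
case: phi_bij => psi _ psiK; exists (psi \o v).
apply: (Zindependent_of_image (phi := phi)) => c.
by under eq_bigr => i _ do rewrite /= psiK; apply: ind.
Qed.

(** * Fixed elements of modules over the integral group ring *)

Lemma val_kernelZ (R : nzRingType) (U V : lmodType R) (f : {linear U -> V}) (r : R)
    (j : kernel f) :
  val (r *: j) = r *: (val j : U).
Proof. by []. Qed.

Lemma linearZ_fst (R : nzRingType) (U A B : lmodType R)
    (f : {linear U -> (A * B)%type}) (r : R) (x : U) :
  (f (r *: x)).1 = r *: (f x).1.
Proof. by rewrite linearZ. Qed.

Section GroupRingNorm.
Variable gT : finGroupType.
Implicit Types (u : zgring gT) (g h x : gT).

Lemma zg_of_mulE x u g : (zg_of x * u) g = u (x^-1 * g)%g.
Proof.
rewrite ffunE (bigD1 x) //= big1 => [|h /negPf hx].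
  by rewrite ffunE eqxx mul1r addr0.
by rewrite ffunE hx mul0r.
Qed.

Lemma mul_zg_ofE u x g : (u * zg_of x) g = u (g * x^-1)%g.
Proof.
rewrite ffunE (bigD1 (g * x^-1)%g) //= big1 => [|h /negPf hx].
  by rewrite ffunE invMg invgK mulgKV eqxx mulr1 addr0.
rewrite ffunE -(inj_eq (mulgI h)) mulKVg eq_sym.
by rewrite -(inj_eq (mulIg x^-1)%g) mulgK hx mulr0.
Qed.

(** The norm element, the sum of all group elements. *)
Definition zg_norm : zgring gT := [ffun=> 1].

Definition augmentation u : int := \sum_g u g.

Lemma mul_zg_norm u : u * zg_norm = zg_norm *~ augmentation u.
Proof.
apply/ffunP=> g; rewrite ffunE ffunMzE ffunE intz.
by apply: eq_bigr => h _; rewrite ffunE mulr1.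
Qed.

Lemma zg_of_mul_norm x : zg_of x * zg_norm = zg_norm.
Proof. by apply/ffunP=> g; rewrite zg_of_mulE !ffunE. Qed.

Lemma zg_norm_mul_of x : zg_norm * zg_of x = zg_norm.
Proof. by apply/ffunP=> g; rewrite mul_zg_ofE !ffunE. Qed.

Lemma zg_norm_of_fixed u : (forall g, u * zg_of g = u) -> u = zg_norm *~ u 1%g.
Proof.
move=> fix_u; apply/ffunP=> g.
by rewrite ffunMzE ffunE intz -[in LHS](fix_u g) mul_zg_ofE mulgV.
Qed.

Lemma zg_norm_mulz_inj : injective (fun c : int => zg_norm *~ c).
Proof. by move=> c d /ffunP/(_ 1%g); rewrite !ffunMzE !ffunE !intz. Qed.

(** Under the left action of the converse ring, [zg_of g *: m] is [m g]. *)
Definition fixed (M : lmodType (zgring gT)^c) (m : M) : Prop :=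
  forall g, (zg_of g : (zgring gT)^c) *: m = m.

Lemma fixed_sum (M : lmodType (zgring gT)^c) (r : nat) (v : 'I_r -> M)
    (c : 'I_r -> int) :
  (forall i, fixed (v i)) -> fixed (\sum_i v i *~ c i).
Proof.
move=> fix_v g; rewrite scaler_sumr; apply: eq_bigr => i _.
by rewrite -scalerMzr fix_v.
Qed.

Lemma fixed_linear (M N : lmodType (zgring gT)^c) (f : {linear M -> N}) m :
  fixed m -> fixed (f m).
Proof. by move=> fix_m g; rewrite -linearZ fix_m. Qed.

Lemma fixed_zg_norm (M : lmodType (zgring gT)^c) (m : M) :
  fixed ((zg_norm : (zgring gT)^c) *: m).
Proof. by move=> g; rewrite scalerA; congr (_ *: _); apply: zg_norm_mul_of. Qed.

Lemma fixed_row p (v : 'rV[(zgring gT)^c]_p) i j :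
  fixed v -> v i j = zg_norm *~ (v i j : zgring gT) 1%g.
Proof.
move=> fix_v; apply: zg_norm_of_fixed => g.
by have /matrixP/(_ i j) := fix_v g; rewrite mxE.
Qed.

(** Vanishing of the zeroth Tate cohomology of a free module. *)
Lemma fixed_row_norm p (v : 'rV[(zgring gT)^c]_p) :
  fixed v -> exists u : 'rV_p, v = (zg_norm : (zgring gT)^c) *: u.
Proof.
move=> fix_v; exists (\row_i (1 *~ (v 0 i : zgring gT) 1%g)).
apply/rowP=> i; rewrite !mxE [LHS]fixed_row //.
exact: esym (mulrzr _ _).
Qed.

Lemma is_Zrank_free p : is_Zrank 'rV[(zgring gT)^c]_p (p * #|gT|).
Proof.
pose phi (v : 'rV[(zgring gT)^c]_p) : {ffun 'I_p * gT -> int} :=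
  [ffun ig => (v 0 ig.1 : zgring gT) ig.2].
have phi_add : zmod_morphism phi.
  by move=> u v; apply/ffunP=> ig; rewrite !ffunE !mxE ffunE [X in _ + X]ffunE.
pose phiA := HB.pack_for {additive 'rV[(zgring gT)^c]_p -> {ffun 'I_p * gT -> int}}
  phi (GRing.isZmodMorphism.Build _ _ phi phi_add).
have <- : #|{: 'I_p * gT}| = (p * #|gT|)%N by rewrite card_prod card_ord.
apply: (is_Zrank_bij (phi := phiA)) (is_Zrank_ffun _).
exists (fun w : {ffun 'I_p * gT -> int} => \row_i ([ffun g => w (i, g)] : zgring gT)).
  by move=> v; apply/rowP=> i; rewrite mxE; apply/ffunP=> g; rewrite !ffunE.
by move=> w; apply/ffunP=> -[i g]; rewrite ffunE mxE ffunE.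
Qed.

Lemma fixed_kernel (M N : lmodType (zgring gT)^c) (f : {linear M -> N})
    (j : kernel f) :
  fixed j <-> fixed (val j : M).
Proof.
split=> fix_j g; first by rewrite -val_kernelZ fix_j.
by apply: val_inj; rewrite val_kernelZ fix_j.
Qed.

Lemma fixed_pair (M N : lmodType (zgring gT)^c) (m : M) (m' : N) :
  fixed m -> fixed m' -> fixed (m, m').
Proof. by move=> fix_m fix_m' g; congr pair; [apply: fix_m | apply: fix_m']. Qed.

Lemma fixed_fst (M N : lmodType (zgring gT)^c) (m : (M * N)%type) :
  fixed m -> fixed m.1.
Proof. by move=> fix_m g; apply: (congr1 fst (fix_m g)). Qed.

Lemma fixed_snd (M N : lmodType (zgring gT)^c) (m : (M * N)%type) :
  fixed m -> fixed m.2.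
Proof. by move=> fix_m g; apply: (congr1 snd (fix_m g)). Qed.

Lemma fixed0 (M : lmodType (zgring gT)^c) : fixed (0 : M).
Proof. by move=> g; rewrite scaler0. Qed.

End GroupRingNorm.

Lemma norm_basis_Zindependent (gT : finGroupType) p :
  Zindependent (fun i : 'I_p =>
    (zg_norm gT : (zgring gT)^c) *: (delta_mx 0 i : 'rV[(zgring gT)^c]_p)).
Proof.
move=> c c0 i; apply: (@zg_norm_mulz_inj gT); rewrite mulr0z.
have /rowP/(_ i) := c0; rewrite summxE !mxE => <-.
rewrite (bigD1 i) //= big1 ?addr0 => [|j /negPf ji].
  by rewrite scalerMzl !mxE !eqxx mulr1.
by rewrite scalerMzl !mxE eq_sym ji mulr0.
Qed.

(** * The module J over the dihedral group ring *)

Lemma mem_mul_index2 (gT : finGroupType) (H : {group gT}) (x y : gT) :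
  #|[set: gT] : H|%g = 2 -> (x * y \in H)%g = ((x \in H) == (y \in H)).
Proof.
move=> indexH; have [xH | xH] := boolP (x \in H); first by rewrite groupMl.
have [yH | yH] := boolP (y \in H); first by rewrite groupMr // (negPf xH).
have x_out : (x^-1 \in [set: gT] :\: H)%g by rewrite !inE groupV xH.
have /setP/(_ y) := rcoset_index2 (subsetT H) indexH x_out.
have nH : (x^-1 \in 'N(H))%g.
  by apply: (subsetP (normal_norm (index2_normal (subsetT H) indexH))); rewrite inE.
by rewrite (norm_rlcoset nH) mem_lcoset invgK !inE yH.
Qed.

Section DihedralJ.
Variables (n : nat) (a b : 'D_(4 * n)).
Hypotheses (n_gt0 : (0 < n)%N) (gen_ab : dihedral_generators a b).
Local Notation ZD := (zgring 'D_(4 * n)).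
Implicit Type j : J a b.

Lemma card_D4n : #|[set: 'D_(4 * n)]| = (4 * n)%N.
Proof.
have -> : (4 * n = (2 * n).*2)%N by rewrite -mul2n mulnA.
by apply: card_dihedral; rewrite mul2n -addnn (leq_add n_gt0).
Qed.

(** The group is the product of [<[a]>] and [<[b]>], whose orders are at most
    [2 * n] and [2]; since the group has order [4 * n], both bounds are attained
    and the two subgroups meet trivially. *)
Lemma rotations_index2 : #|[set: 'D_(4 * n)] : <[a]>|%g = 2 /\ b \notin <[a]>%g.
Proof.
have [defG aq b2 aba] := gen_ab.
have nAb : (<[b]> \subset 'N(<[a]>))%g.
  have ab : (a ^ b = a^-1)%g.
    by apply: (mulgI b); rewrite -conjgC -{2}aba mulgK.
  by rewrite cycle_subG inE -cycleJ ab cycleV.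
have a_le : (#[a]%g <= 2 * n)%N.
  by apply: dvdn_leq; [rewrite muln_gt0 | rewrite order_dvdn aq].
have b_le : (#[b]%g <= 2)%N by apply: dvdn_leq; rewrite // order_dvdn b2.
have defAB : (<[a]> * <[b]> = [set: 'D_(4 * n)])%g.
  by rewrite -norm_joinEr // -defG joing_idl joing_idr.
have ab_ge : (4 * n <= #[a]%g * #[b]%g)%N.
  apply: (@leq_trans #|[set: 'D_(4 * n)]|); first by rewrite card_D4n.
  by rewrite -defAB /order mul_cardG leq_pmulr // cardG_gt0.
have a2n : #[a]%g = (2 * n)%N.
  apply/eqP; rewrite eqn_leq a_le -(leq_pmul2r (isT : 0 < 2)%N) mulnAC.
  by apply: leq_trans ab_ge _; rewrite leq_mul2l b_le orbT.
split.
  rewrite -divgS ?subsetT // card_D4n.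
  rewrite [#|<[a]>%g|]a2n.
  by rewrite (_ : 4 = 2 * 2)%N // -mulnA mulnK // muln_gt0.
apply: contraTN n_gt0 => bA.
have : <[a]>%g = [set: 'D_(4 * n)].
  by rewrite -defAB mulGSid // cycle_subG.
move/(congr1 (fun A : {set _} => #|A|)); rewrite card_D4n [#|_|]a2n.
by move/eqP; rewrite eqn_pmul2r.
Qed.

(** The linear character of the dihedral group sending [a] to [1] and [b] to
    [-1]. *)
Definition b_sign (g : 'D_(4 * n)) : int := (-1) ^+ (g \notin <[a]>%g).

Lemma b_signM g h : b_sign (g * h)%g = b_sign g * b_sign h.
Proof.
rewrite /b_sign (mem_mul_index2 _ _ (proj1 rotations_index2)) -signr_addb.
by case: (g \in _); case: (h \in _).
Qed.

Definition b_char (u : ZD) : int := \sum_g b_sign g * u g.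

Lemma b_charD u v : b_char (u + v) = b_char u + b_char v.
Proof. by rewrite -big_split; apply: eq_bigr => g _; rewrite ffunE mulrDr. Qed.

Lemma b_char_zg_of x u : b_char (zg_of x * u) = b_sign x * b_char u.
Proof.
rewrite /b_char (reindex_inj (mulgI x)) mulr_sumr; apply: eq_bigr => g _ /=.
by rewrite zg_of_mulE mulKg b_signM mulrA.
Qed.

Lemma b_char_Sigma u : b_char (Sigma a * u) = b_char u *+ (2 * n).
Proof.
have b_char0 : b_char 0 = 0 by apply: big1 => g _; rewrite ffunE mulr0.
rewrite mulr_suml (big_morph _ b_charD b_char0) -[X in _ *+ X]card_ord -sumr_const.
apply: eq_bigr => i _.
by rewrite b_char_zg_of /b_sign mem_cycle mul1r.
Qed.

(** The character [b_char] kills [1 + ba] and sends [Sigma a] to [2n], so the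
    equation forces it to vanish on [u1]; and it agrees with the augmentation
    modulo 2, the two characters differing by signs only. *)
Lemma augmentation_even u1 u3 :
  Sigma a * u1 + (1 + zg_of (b * a)%g) * u3 = 0 ->
  exists m, augmentation u1 = m *+ 2.
Proof.
move/(congr1 b_char); rewrite mulrDl mul1r !b_charD b_char_Sigma b_char_zg_of.
have -> : b_sign (b * a)%g = -1.
  by rewrite /b_sign groupMr ?cycle_id // (proj2 rotations_index2).
rewrite mulN1r subrr addr0 [RHS]big1 => [|g _]; last by rewrite ffunE mulr0.
move/eqP; rewrite Num.Theory.mulrn_eq0 muln_eq0 /= -leqn0 leqNgt n_gt0 /=.
move=> /eqP char_u1.
exists (\sum_(g | g \notin <[a]>%g) u1 g).
rewrite /augmentation -[LHS]subr0 -[X in _ - X]char_u1.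
rewrite -sumrB -sumrMnl [RHS]big_mkcond.
apply: eq_bigr => g _; rewrite /b_sign.
by case: (g \in _) => /=; rewrite ?mul1r ?subrr // mulN1r opprK mulr2n.
Qed.

Lemma J_eqs j : let v : 'rV[ZD^c]_3 := val j in
  (Sigma a : ZD) * v 0 0 + (1 + zg_of (b * a)%g) * v 0 2 = 0 /\
  (1 + zg_of b : ZD) * v 0 1 + (zg_of a - 1) * v 0 2 = 0.
Proof.
have [d2_0 d2_1] := d2E a b (val j).
have /eqP d2j : d2 a b (val j) == 0 := valP j.
by rewrite d2j !mxE in d2_0 d2_1; split.
Qed.

Lemma Sigma_mul_norm : Sigma a * zg_norm _ = zg_norm _ *~ (2 * n)%N.
Proof.
rewrite mulr_suml -[X in _ *~ Posz X]card_ord -[RHS]sumr_const.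
by apply: eq_bigr => i _; rewrite zg_of_mul_norm.
Qed.

(** A fixed vector is [N (x, y, z)] with integers [x], [y], [z], and it lies in [J]
    iff [2 n x + 2 z = 0] and [2 y = 0]. So [x] determines it: the fixed
    submodule has rank 1. *)
Lemma fixed_J_eq0 j : fixed j -> ((val j : 'rV[ZD^c]_3) 0 0 : ZD) 1%g = 0 -> j = 0.
Proof.
move=> fix_j; set v : 'rV[ZD^c]_3 := val j => v0.
have fix_v : fixed v := proj1 (fixed_kernel (f := d2 a b) j) fix_j.
have [] := J_eqs j; rewrite -/v.
have -> : v 0 0 = 0 by rewrite fixed_row // v0 mulr0z.
rewrite mulr0 add0r (fixed_row 0 2 fix_v) (fixed_row 0 1 fix_v).
rewrite !mulrzAr !mulrDl !mul1r mulN1r !zg_of_mul_norm subrr mul0rz addr0.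
have norm2_inj (c : int) : (zg_norm 'D_(4 * n) + zg_norm _) *~ c = 0 -> c = 0.
  move/ffunP/(_ 1%g); rewrite ffunMzE !ffunE mulrzz => /eqP.
  by rewrite mulf_eq0 /= => /eqP.
move=> /norm2_inj v2 /norm2_inj v1; apply: val_inj; apply/rowP=> i.
rewrite [LHS](fixed_row 0 i fix_v) -/v mxE.
suff -> : (v 0 i : ZD) 1%g = 0 by rewrite mulr0z.
case: i => [[|[|[|//]]] lti];
  [rewrite -[RHS]v0 | rewrite -[RHS]v1 | rewrite -[RHS]v2];
  by congr (fun_of_matrix v 0 _ _); apply: val_inj.
Qed.

(** The vector [N (1, 0, - n)], generating the fixed submodule of [J]: here
    [Sigma a * N = 2n N] and [(1 + ba) N = 2 N]. *)
Lemma norm_generator_exists : exists w : J a b, fixed w /\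
  (val w : 'rV[ZD^c]_3) 0 0 = zg_norm _.
Proof.
pose w : 'rV[ZD^c]_3 := \row_i (if i == 0 then zg_norm _ else
   if i == 2 then zg_norm _ *~ - n%:Z else 0).
have fix_w : fixed w.
  move=> g; apply/rowP=> i; rewrite !mxE.
  case: ifP => _; first exact: zg_norm_mul_of.
  case: ifP => _; last by rewrite mulr0.
  by rewrite mulrzAr; congr (_ *~ _); exact: zg_norm_mul_of.
have w_ker : w \in in_ker (d2 a b).
  have [] := d2E a b w.
  have -> : w 0 0 = zg_norm _ by rewrite mxE.
  have -> : w 0 1 = 0 by rewrite mxE.
  have -> : w 0 2 = zg_norm _ *~ - n%:Z by rewrite mxE.
  rewrite mulr0 add0r Sigma_mul_norm !mulrzAr !mulrDl !mul1r mulN1r !zg_of_mul_norm.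
  rewrite subrr mul0rz => w0 w1.
  have {}w0 : d2 a b w 0 0 = 0.
    by rewrite w0 mulrzDl -!mulrzDr mul2n -addnn PoszD addrACA subrr addr0 mulr0z.
  apply/eqP/rowP=> i; rewrite [RHS]mxE.
  by case: i => [[|[|//]] lti]; [rewrite -[RHS]w0 | rewrite -[RHS]w1];
    congr (fun_of_matrix _ 0 _); apply: val_inj.
exists (Sub w w_ker); split; last by rewrite SubK mxE.
by apply: (proj2 (fixed_kernel (f := d2 a b) _)); rewrite SubK.
Qed.

(** The zeroth Tate cohomology of [J], which is the second homology group
    [Z/2] of the dihedral group, does not vanish. Indeed the first coordinate of
    [j N] is its augmentation times [N], and that augmentation is even, not 1. *)
Lemma norm_generator_not_norm j :
  ((zg_norm _ : ZD^c) *: (val j : 'rV[ZD^c]_3)) 0 0 <> zg_norm _.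
Proof.
set v : 'rV[ZD^c]_3 := val j.
have -> : ((zg_norm _ : ZD^c) *: v) 0 0 = (v 0 0 : ZD) * zg_norm _ by rewrite mxE.
have [m aug_j] := augmentation_even (proj1 (J_eqs j)).
rewrite mul_zg_norm aug_j => /ffunP/(_ 1%g); rewrite ffunMzE !ffunE intz.
by move/(congr1 (fun c : int => odd `|c|)); rewrite -mulr_natr abszM oddM andbF.
Qed.

(** The coefficient at [1] of a fixed group ring element determines it; on the
    summand [J] the first coordinate suffices. So the fixed submodule of
    [J + R^q] has rank at most [1 + q]; the index [None] stands for [J]. *)
Lemma fixed_J_free_coords q :
  exists phi : {additive (J a b * 'rV[ZD^c]_q)%type -> {ffun option 'I_q -> int}},
    forall m, fixed m -> phi m = 0 -> m = 0.
Proof.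
pose phi (m : (J a b * 'rV[ZD^c]_q)%type) : {ffun option 'I_q -> int} :=
  [ffun o => if o is Some i then (m.2 0 i : ZD) 1%g
             else ((val m.1 : 'rV[ZD^c]_3) 0 0 : ZD) 1%g].
have phi_add : zmod_morphism phi.
  by move=> x y; apply/ffunP=> -[i|]; rewrite !ffunE /= !mxE ffunE [X in _ + X]ffunE.
exists (HB.pack_for
  {additive (J a b * 'rV[ZD^c]_q)%type -> {ffun option 'I_q -> int}} phi
  (GRing.isZmodMorphism.Build _ _ phi phi_add)) => -[j u] fix_m phi_m.
congr pair.
  apply: fixed_J_eq0; first exact: (fixed_fst fix_m).
  by have /ffunP/(_ None) := phi_m; rewrite !ffunE.
apply/rowP=> i; rewrite [LHS]fixed_row; last exact: (fixed_snd fix_m).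
by have /ffunP/(_ (Some i)) := phi_m; rewrite !ffunE /= => ->; rewrite mulr0z mxE.
Qed.

Section StableIsomorphism.
Variables (p q : nat) (K : lmodType ZD^c).
Variable f : {linear (K * 'rV[ZD^c]_p)%type -> (J a b * 'rV[ZD^c]_q)%type}.
Hypothesis f_bij : bijective f.

(** Tate cohomology is a stable invariant and vanishes where there is no nonzero
    fixed element. Concretely, let [(k, v)] correspond to [(w, 0)], with [w] the
    generator of the fixed elements of [J]; [v] is a norm, so if [k] were 0 then
    [w] would be a norm. *)
Lemma nonzero_fixed_exists : exists2 k : K, fixed k & k != 0.
Proof.
have [w [fix_w w00]] := norm_generator_exists.
have [g fK gK] := f_bij.
have fix_gw : fixed (g (w, 0)).
  move=> x; apply: (bij_inj f_bij); rewrite linearZ /= gK.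
  exact: (fixed_pair fix_w (fixed0 _) x).
exists (g (w, 0)).1; first exact: fixed_fst.
have [u def_v] := fixed_row_norm (fixed_snd fix_gw).
apply/eqP=> k0; apply: (norm_generator_not_norm (j := (f (0, u)).1)).
rewrite -(val_kernelZ (f := d2 a b)) -linearZ_fst.
rewrite -[RHS]w00 (_ : _ *: (0, u) = g (w, 0)) ?gK //.
by rewrite [RHS]surjective_pairing k0 def_v; congr pair; rewrite /= scaler0.
Qed.

(** A nonzero fixed element of [K] and the norms of the basis vectors of [R^p] are
    [1 + p] independent fixed elements, while fixed elements of [J + R^q] have
    only [1 + q] coordinates. *)
Lemma free_summand_le : (p <= q)%N.
Proof.
have [k fix_k k_neq0] := nonzero_fixed_exists.
have [phi phi0] := fixed_J_free_coords q.
have k_ind : Zindependent (fun _ : 'I_1 => k).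
  (* K is torsion free at fixed elements, as phi is injective on their images. *)
  move=> c; rewrite big_ord1 => kc0 i; rewrite [i]ord1; apply/eqP/negPn/negP=> c0.
  have f_k0 : f (k, 0) = 0.
    apply: phi0; first exact: fixed_linear (fixed_pair fix_k (fixed0 _)).
    apply/ffunP=> o; have : phi (f (k, 0) *~ c ord0) = 0.
      rewrite -(raddfMz f) (_ : _ *~ _ = 0) ?raddf0 // [LHS]surjective_pairing.
      by rewrite (raddfMz fst) (raddfMz snd) /= kc0 mul0rz.
    rewrite raddfMz => /ffunP/(_ o); rewrite ffunMzE !ffunE mulrzz => /eqP.
    by rewrite mulf_eq0 (negPf c0) orbF => /eqP.
  move: f_k0; rewrite -(raddf0 f) => /(bij_inj f_bij)[k0].
  by rewrite k0 eqxx in k_neq0.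
pose norms (i : 'I_p) := (zg_norm _ : ZD^c) *: (delta_mx 0 i : 'rV[ZD^c]_p).
pose t := pair_family (fun _ : 'I_1 => k) norms.
have fix_t i : fixed (t i).
  rewrite /t /pair_family; case: (split i) => l; apply: fixed_pair => //.
  - exact: fixed0.
  - exact: fixed0.
  - exact: fixed_zg_norm.
have ind_ft : Zindependent (fun i => f (t i)).
  apply: Zindependent_inj (bij_inj f_bij) _.
  exact: Zindependent_pair k_ind (@norm_basis_Zindependent _ p).
rewrite -(leq_add2l 1).
have <- : #|{: option 'I_q}| = (1 + q)%N by rewrite card_option card_ord.
apply: (@Zindependent_ffun_le _ (1 + p) (fun i => phi (f (t i)))) => c cv0.
apply: ind_ft; apply: phi0.
  by apply: fixed_sum => i; apply: fixed_linear.
by rewrite raddf_sum -[RHS]cv0; apply: eq_bigr => i _; rewrite raddfMz.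
Qed.

End StableIsomorphism.

End DihedralJ.

Theorem proposition2p3p2 (n : nat) (n_ge1 : (1 <= n)%N)
    (a b : 'D_(4 * n)) (gen_ab : dihedral_generators a b)
    (K : lmodType (zgring 'D_(4 * n))^c) (stab_KJ : stably_equivalent K (J a b)) :
  exists rK rJ : nat,
    [/\ is_Zrank K rK, is_Zrank (J a b) rJ & (rJ <= rK)%N].
Proof.
have [p [q [f f_bij]]] := stab_KJ; pose RG := (zgring 'D_(4 * n))^c.
pose free_rank := @is_Zrank_free 'D_(4 * n).
have [rJ rankJ] : exists r, is_Zrank (J a b) r.
  exact: (is_Zrank_of_inj (phi := val : {additive J a b -> 'rV[RG]_3}))
    val_inj (free_rank 3).
have rankJq := is_Zrank_prod rankJ (free_rank q).
have rankKp := is_Zrank_bij f_bij rankJq.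
have [rK rankK] : exists r, is_Zrank K r.
  exact: is_Zrank_fst rankKp.
exists rK, rJ; split=> //.
have le_pq := free_summand_le n_ge1 gen_ab f_bij.
have := is_Zrank_surj_le (phi := f) _ (is_Zrank_prod rankK (free_rank p)) rankJq.
have [g _ gK] := f_bij => /(_ (fun y => ex_intro _ (g y) (gK y))) le_r.
rewrite -(leq_add2r (p * #|'D_(4 * n)|)); apply: leq_trans le_r.
by rewrite leq_add2l leq_mul2r le_pq orbT.
Qed.
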